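(* Let $T\in\mathcal{L}(\mathcal{H})$ have closed range and let $p(z)=a_nz^n+a_{n-1}z^{n-1}+\cdots+a_0$ with $a_0,a_1,\ldots,a_n\in\mathbb{C}$. The following statements are equivalent: (i) $T$ is $p$-hypo-EP; (ii) $T^\dagger T\,p(T)\,T^*T=p(T)\,T^*T$; (iii) $T^\dagger T\,p(T)\,T^*=p(T)\,T^*$.
   Context: $\mathcal{H}$ is a complex Hilbert space and $\mathcal{L}(\mathcal{H})$ is the algebra of bounded linear operators on $\mathcal{H}$. For $T\in\mathcal{L}(\mathcal{H})$ with closed range, the Moore-Penrose inverse $T^\dagger$ is the unique operator with $TT^\dagger T=T$, $T^\dagger TT^\dagger=T^\dagger$, $(T^\dagger T)^*=T^\dagger T$, $(TT^\dagger)^*=TT^\dagger$. For a complex polynomial $p$ (the notion is introduced for nontrivial $p$), a closed range operator $T$ is $p$-hypo-EP ($p$-HEP) if $T^\dagger T\,p(T)=p(T)\,T^\dagger T$. *)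

(* Defs.v *)
From HB Require Import structures.
From mathcomp Require Import all_boot all_order all_algebra.
From mathcomp Require Import all_classical all_reals all_analysis.
From mathcomp Require Import complex.

Set Implicit Arguments.
Unset Strict Implicit.
Unset Printing Implicit Defensive.

Import Order.TTheory GRing.Theory Num.Theory.
Import numFieldNormedType.Exports.

Local Open Scope classical_set_scope.
Local Open Scope ring_scope.

(* A complex Hilbert space is a complete normed R[i]-module [H] together with
   a positive definite hermitian form [dot] (linear in its first argument)
   from which the norm of [H] derives, i.e. such that
   [induces_norm dot] holds. *)
Definition induces_norm (R : realType) (H : completeNormedModType R[i])
    (dot : {dot H for Num.conj}) : Prop :=
  forall x : H, `|x| = sqrtC (dot x x).

(* [L(H)]. For a linear map, being bounded near 0 is being bounded in operator
   norm (linear_boundedP). *)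
Definition bounded_operator (R : realType) (H : completeNormedModType R[i]) :
    set (H -> H) :=
  [set T | linear T /\ bounded_near T (nbhs (0 : H))].

Definition is_adjoint (R : realType) (H : completeNormedModType R[i])
    (dot : {dot H for Num.conj}) (T : H -> H) : set (H -> H) :=
  [set S | bounded_operator S /\ forall x y, dot (T x) y = dot x (S y)].

(* [adjoint] and [mp_inverse] select the unique element of [is_adjoint dot T]
   and [is_mp_inverse dot T]; there is one when the norm of [H] derives from
   [dot] and [T] is bounded, with closed range in the second case. Otherwise
   their value is arbitrary. *)
Definition adjoint (R : realType) (H : completeNormedModType R[i])
    (dot : {dot H for Num.conj}) (T : H -> H) : H -> H :=
  get (is_adjoint dot T).

Definition is_mp_inverse (R : realType) (H : completeNormedModType R[i])
    (dot : {dot H for Num.conj}) (T : H -> H) : set (H -> H) :=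
  [set S | [/\ bounded_operator S,
               T \o S \o T = T,
               S \o T \o S = S,
               adjoint dot (S \o T) = S \o T &
               adjoint dot (T \o S) = T \o S]].

Definition mp_inverse (R : realType) (H : completeNormedModType R[i])
    (dot : {dot H for Num.conj}) (T : H -> H) : H -> H :=
  get (is_mp_inverse dot T).

(* [horner_alg] does not apply: the endomorphisms of [H] form a nontrivial
   ring only if [H] is not 0. *)
Definition op_horner (R : realType) (H : completeNormedModType R[i])
    (p : {poly R[i]}) (T : H -> H) : H -> H :=
  fun x => \sum_(i < size p) p`_i *: iter i T x.

Definition hypo_EP (R : realType) (H : completeNormedModType R[i])
    (dot : {dot H for Num.conj}) (p : {poly R[i]}) (T : H -> H) : Prop :=
  mp_inverse dot T \o T \o op_horner p T
  = op_horner p T \o (mp_inverse dot T \o T).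

(* Main.v *)
Require Import Defs.
From HB Require Import structures.
From mathcomp Require Import all_boot all_order all_algebra.
From mathcomp Require Import all_classical all_reals all_analysis.
From mathcomp Require Import complex.
From mathcomp Require Import ring lra.

Set Implicit Arguments.
Unset Strict Implicit.
Unset Printing Implicit Defensive.

Import Order.TTheory GRing.Theory Num.Theory.
Import numFieldNormedType.Exports.

Local Open Scope classical_set_scope.
Local Open Scope ring_scope.
Local Open Scope complex_scope.

(** Write [Td] for the Moore-Penrose inverse, [Ts] for the adjoint and [pT] for
    [p(T)], and let [P = Td T], the orthogonal projection along the kernel of
    [T]. Taking adjoints in [T Td T = T] gives [P Ts = Ts] and [Ts T Td = Ts];
    and [P = Ts S] with [S] the adjoint of [Td].
    - If [P] commutes with [pT], then [P pT Ts = pT P Ts = pT Ts].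
    - [P pT Ts = pT Ts] gives [P pT Ts T = pT Ts T] by composing with [T] on
      the right, and follows from it by composing with [Td] on the right, as
      [Ts T Td = Ts].
    - Composing [P pT Ts = pT Ts] with [S] on the right gives [P pT P = pT P].
      The other part of [P pT], namely [P pT (1 - P)], always vanishes: [1 - P]
      has its values in the kernel of [T], where [pT] is multiplication by the
      constant term of [p], and [P] kills that kernel. Hence [P pT = pT P].

    The bulk of the text shows that [Ts] and [Td] exist, so that the choices
    made by [adjoint] and [mp_inverse] satisfy their specifications. Adjoints
    come from orthogonal projection on closed subspaces
    ([orthogonal_projection]) through [riesz_representation]. For the
    Moore-Penrose inverse, the closed range of [T] and the uniform boundedness
    principle ([weakly_bounded_rnorm]) make [Ts] bounded below on the range of
    [T] ([adjoint_bounded_below]); then [T Ts] is invertible on that range, and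
    [Td] is [Ts] after its inverse after the projection on the range
    ([mp_inverse_exists]). This takes the place of the open mapping theorem. *)

(** * The norm as a real number *)

Lemma div_nat_lt (R : realType) (C d : R) :
  0 <= C -> 0 < d -> exists n : nat, C / n.+1%:R < d.
Proof.
move=> C0 d0; exists (Num.truncn (C / d)).
by rewrite ltr_pdivrMr// mulrC -ltr_pdivrMr// truncnS_gt.
Qed.

Section RealNorm.
Context {R : realType} {H : completeNormedModType R[i]}.

(** The norm of [H] takes its values in [R[i]], which is only partially
    ordered; its real part carries the same information in the totally ordered
    [R], where infima exist. *)
Definition rnorm (x : H) : R := complex.Re `|x|.

Lemma rnormE x : `|x| = (rnorm x)%:C.
Proof. by rewrite RRe_real// normr_real. Qed.

Lemma rnorm_ge0 x : 0 <= rnorm x.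
Proof. by rewrite -ler0c -rnormE normr_ge0. Qed.

Lemma rnorm0_eq0 x : rnorm x = 0 -> x = 0.
Proof. by move=> x0; apply: normr0_eq0; rewrite rnormE x0. Qed.

Lemma rnorm0 : rnorm 0 = 0.
Proof. by rewrite /rnorm normr0. Qed.

Lemma rnormD x y : rnorm (x + y) <= rnorm x + rnorm y.
Proof. by rewrite -lecR rmorphD/= -!rnormE ler_normD. Qed.

Lemma rnormN x : rnorm (- x) = rnorm x.
Proof. by rewrite /rnorm normrN. Qed.

Lemma rnormB x y : rnorm (x - y) = rnorm (y - x).
Proof. by rewrite -rnormN opprB. Qed.

Lemma rnormZ a x : rnorm (a *: x) = complex.Re `|a| * rnorm x.
Proof.
apply: complexI; rewrite -rnormE normrZ rnormE rmorphM; congr (_ * _).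
Qed.

Lemma rnormZr (a : R) x : rnorm (a%:C *: x) = `|a| * rnorm x.
Proof. by rewrite rnormZ normc_def/= expr0n/= addr0 sqrtr_sqr. Qed.

Lemma ball_rnorm (x y : H) (e : R) : ball x e%:C y <-> rnorm (x - y) < e.
Proof. by rewrite -ball_normE /ball_/= rnormE ltcR. Qed.

Lemma gt0_complex (e : R[i]) :
  0 < e -> e = (complex.Re e)%:C /\ 0 < complex.Re e.
Proof.
move=> e0; have eE : e = (complex.Re e)%:C by rewrite RRe_real// gtr0_real.
by split=> //; rewrite -ltcR -eE.
Qed.

(** The form in which completeness is used: a sequence with an explicit rate of
    convergence has a limit that obeys the same rate. *)
Lemma complete_rnorm (u : nat -> H) (e : nat -> R) :
  (forall d, 0 < d -> exists n, e n < d) ->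
  (forall n m, (n <= m)%N -> rnorm (u m - u n) <= e n) ->
  exists l, forall n, rnorm (l - u n) <= e n.
Proof.
move=> e_small u_e.
have /cauchy_cvgP/cvg_ex[l /= ul] : cauchy (u @ \oo).
  apply: cauchy_exP => d /gt0_complex[-> d0].
  have [n en] := e_small _ d0.
  exists (u n); exists n => // m /= nm.
  by apply/ball_rnorm; rewrite rnormB; apply: le_lt_trans en; apply: u_e.
exists l => n; apply/ler_addgt0Pr => d d0.
have /cvgrPdist_lt/(_ d%:C) := ul; rewrite ltcR => /(_ d0)[N _ uN].
have {uN} := uN (maxn N n) (leq_maxl _ _); rewrite rnormE ltcR => lu.
have := u_e n (maxn N n) (leq_maxr _ _).
have := rnormD (l - u (maxn N n)) (u (maxn N n) - u n).
by rewrite addrA subrK; lra.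
Qed.

Lemma closed_rnorm (S : set H) :
  closed S <->
  forall x, (forall e, 0 < e -> exists2 s, S s & rnorm (x - s) < e) -> S x.
Proof.
split=> [cS x xS|xS x clx].
  apply: cS => B /nbhs_ballP[e /= /gt0_complex[-> e0] xB].
  have [s Ss xs] := xS _ e0.
  by exists s; split=> //; apply: xB; apply/ball_rnorm.
apply: xS => e e0.
have [|s [Ss /ball_rnorm xs]] := clx (ball x e%:C).
  by apply: nbhsx_ballx; rewrite ltcR.
by exists s.
Qed.

Lemma bounded_rnorm (T : H -> H) :
  bounded_operator T <->
  linear T /\ exists2 K : R, 0 <= K & forall x, rnorm (T x) <= K * rnorm x.
Proof.
split=> [[lT bT]|[lT [K K0 TK]]].
  split=> //.
  pose mT := GRing.isLinear.Build _ _ _ _ T lT.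
  pose T' : {linear H -> H} := HB.pack T mT.
  have /linear_boundedP[K0 [K0r K0P]] : bounded_near T' (nbhs (0 : H)) by [].
  have K0le : K0 < (1 + `|complex.Re K0|)%:C.
    rewrite -[K0]RRe_real//= ltcR; apply: le_lt_trans (ler_norm _) _.
    by rewrite /=; lra.
  exists (1 + `|complex.Re K0|) => [|x]; first by rewrite addr_ge0.
  by have := K0P _ K0le x; rewrite !rnormE -rmorphM lecR.
split=> //.
pose mT := GRing.isLinear.Build _ _ _ _ T lT.
pose T' : {linear H -> H} := HB.pack T mT.
suff : bounded_near T' (nbhs (0 : H)) by [].
apply/linear_boundedP; exists K%:C; split; first by rewrite complex_real.
move=> r /ltW Kr x; apply: le_trans (ler_wpM2r _ Kr) => //.
by rewrite !rnormE -rmorphM lecR.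
Qed.

End RealNorm.

(** * Inner products *)

Section InnerProduct.
Context {R : realType} {H : completeNormedModType R[i]}.
Variables (dot : {dot H for Num.conj}) (hdot : induces_norm dot).
Implicit Types x y z : H.

Local Notation ip x y := (complex.Re (dot x y)).

Lemma dotxx x : dot x x = (rnorm x ^+ 2)%:C.
Proof. by rewrite -[LHS]sqrtCK -hdot rnormE [RHS]rmorphXn. Qed.

Lemma rnorm_sqr x : rnorm x ^+ 2 = ip x x.
Proof. by rewrite dotxx. Qed.

Lemma dotC x y : dot x y = (dot y x)^*.
Proof. by rewrite hermC expr0 mul1r. Qed.

Lemma dot_eq0C x y : dot x y = 0 -> dot y x = 0.
Proof. by rewrite dotC => /eqP; rewrite conjc_eq0 => /eqP. Qed.

Lemma dot_inj y z : (forall x, dot x y = dot x z) -> y = z.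
Proof.
move=> yz; apply/eqP; rewrite -subr_eq0; apply/eqP/rnorm0_eq0/eqP.
by rewrite -sqrf_eq0 rnorm_sqr linearBr/= yz subrr.
Qed.

Lemma ipC x y : ip x y = ip y x.
Proof. by rewrite dotC; case: (dot y x). Qed.

Lemma ipDl x y z : ip (x + y) z = ip x z + ip y z.
Proof. by rewrite linearDl/= raddfD. Qed.

Lemma ipBl x y z : ip (x - y) z = ip x z - ip y z.
Proof. by rewrite linearBl/= raddfB. Qed.

Lemma ipBr x y z : ip z (x - y) = ip z x - ip z y.
Proof. by rewrite linearBr/= raddfB. Qed.

Lemma ipZl (a : R) x y : ip (a%:C *: x) y = a * ip x y.
Proof.
by rewrite linearZl_LR/=; case: (dot x y) => b c /=; rewrite mul0r subr0.
Qed.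

Lemma ipZr (a : R) x y : ip x (a%:C *: y) = a * ip x y.
Proof. by rewrite ipC ipZl ipC. Qed.

Lemma rnormBZ_sqr x y (t : R) :
  rnorm (x - t%:C *: y) ^+ 2 =
  rnorm x ^+ 2 - 2 * t * ip x y + t ^+ 2 * rnorm y ^+ 2.
Proof.
rewrite !rnorm_sqr ipBl !ipBr !ipZl !ipZr (ipC y x); ring.
Qed.

(** Cauchy-Schwarz with a defect: if moving [x] along [y] lowers its squared
    norm by at most [d ^+ 2], then [x] is orthogonal to [y] up to [d]. With
    [d = rnorm x] the hypothesis is trivial and this is Cauchy-Schwarz; with small
    [d] it says that near-minimizers of a distance are nearly orthogonal. *)
Lemma ip_le x y (d : R) : 0 <= d ->
  (forall t : R, rnorm x ^+ 2 <= rnorm (x - t%:C *: y) ^+ 2 + d ^+ 2) ->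
  ip x y <= d * rnorm y.
Proof.
move=> d0 xy; have := rnorm_ge0 y; rewrite le_eqVlt => /predU1P[y0|y0].
  have -> : y = 0 by apply: rnorm0_eq0.
  by rewrite linear0r rnorm0 mulr0.
(* the minimizer of the quadratic polynomial in [t] *)
have := xy (ip x y / rnorm y ^+ 2); rewrite rnormBZ_sqr.
set a := ip x y; set n := rnorm y in y0 *.
have -> : rnorm x ^+ 2 - 2 * (a / n ^+ 2) * a + (a / n ^+ 2) ^+ 2 * n ^+ 2 =
          rnorm x ^+ 2 - a ^+ 2 / n ^+ 2 by field; lra.
rewrite -addrA lerDl addrC subr_ge0 ler_pdivrMr ?exprn_gt0// -exprMn.
have dn : 0 <= d * n by rewrite mulr_ge0// ltW.
have [a0|a0 _] := leP 0 a; first by rewrite ler_sqr ?nnegrE.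
by rewrite (le_trans _ dn)// ltW.
Qed.

Lemma ip_rnorm x y : ip x y <= rnorm x * rnorm y.
Proof. by apply: ip_le => [|t]; rewrite ?rnorm_ge0// lerDr sqr_ge0. Qed.

Lemma dot_rnorm x y : complex.Re `|dot x y| <= rnorm x * rnorm y.
Proof.
have [d0|d0] := eqVneq (dot x y) 0.
  by rewrite d0 normr0 mulr_ge0// rnorm_ge0.
(* a unimodular factor that turns [dot x y] into its modulus, so that the real
   inequality applies *)
pose c := (dot x y)^* / `|dot x y|.
have nd0 : `|dot x y| != 0 by rewrite normr_eq0.
have nc : `|c| = 1 by rewrite normrM normfV normr_id normcJ divff.
have -> : `|dot x y| = dot (c *: x) y.
  rewrite linearZl_LR/= mulrAC [_^* * _]mulrC -sqr_normc expr2 -mulrA.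
  by rewrite mulfV// mulr1.
by rewrite (le_trans (ip_rnorm _ _))// rnormZ nc mul1r.
Qed.

End InnerProduct.

(** * Subspaces and operators *)

Definition subspace (R : realType) (H : completeNormedModType R[i]) :
    set (set H) :=
  [set S | S 0 /\ forall a x y, S x -> S y -> S (a *: x + y)].

Section Operators.
Context {R : realType} {H : completeNormedModType R[i]}.
Implicit Types (x y z : H) (N S : set H) (T U : H -> H).

Lemma subspaceN S x : subspace S -> S x -> S (- x).
Proof. by move=> [S0 SP] Sx; rewrite -[- x]addr0 -scaleN1r; apply: SP. Qed.

Lemma subspaceB S x y : subspace S -> S x -> S y -> S (x - y).
Proof.
by move=> sS Sx Sy; rewrite -[x]scale1r; apply: sS.2 => //; apply: subspaceN.
Qed.

Lemma subspaceZ S a x : subspace S -> S x -> S (a *: x).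
Proof. by move=> [S0 SP] Sx; rewrite -[_ *: _]addr0; apply: SP. Qed.

Lemma linear_funP T : linear T ->
  [/\ T 0 = 0, forall a x, T (a *: x) = a *: T x,
      forall x y, T (x + y) = T x + T y & forall x y, T (x - y) = T x - T y].
Proof.
move=> lT; pose mT := GRing.isLinear.Build _ _ _ _ T lT.
pose T' : {linear H -> H} := HB.pack T mT.
split; [exact: (linear0 T')|exact: (linearZ_LR T')|exact: (linearD T')|].
exact: (linearB T').
Qed.

Lemma bounded_operator_comp T U :
  bounded_operator T -> bounded_operator U -> bounded_operator (T \o U).
Proof.
move=> /bounded_rnorm[lT [K K0 TK]] /bounded_rnorm[lU [L L0 UL]].
apply/bounded_rnorm; split=> [a x y|] /=; first by rewrite lU lT.
exists (K * L) => [|x /=]; first by rewrite mulr_ge0.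
by rewrite (le_trans (TK _))// -mulrA ler_wpM2l.
Qed.

Lemma subspace_image T N : linear T -> subspace N -> subspace (T @` N).
Proof.
move=> lT sN; have [T0 _ _ _] := linear_funP lT; split.
  by exists 0; first exact: sN.1.
move=> a _ _ [x Nx <-] [y Ny <-].
by exists (a *: x + y); [exact: sN.2|rewrite lT].
Qed.

(** An operator bounded below on [N] reflects Cauchy sequences of [T @` N] to
    [N], where they have a limit. *)
Lemma closed_image T N (C : R) : bounded_operator T -> subspace N -> closed N ->
  0 <= C -> (forall x, N x -> rnorm x <= C * rnorm (T x)) -> closed (T @` N).
Proof.
move=> /bounded_rnorm[lT [K K0 TK]] sN /closed_rnorm cN C0 TC.
have [_ _ _ TB] := linear_funP lT.
apply/closed_rnorm => y yTN.
pose r n : R := n.+1%:R^-1.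
have r0 n : 0 <= r n by rewrite invr_ge0.
have rW n m : (n <= m)%N -> r m <= r n.
  by move=> nm; rewrite lef_pV2 ?posrE ?ltr0n// ler_nat.
have r_small M d : 0 <= M -> 0 < d -> exists n, M * r n < d.
  exact: div_nat_lt.
have /choice[x x_lim] n : exists x, N x /\ rnorm (y - T x) < r n.
  have [|_ [x Nx <-] yx] := yTN (r n); first by rewrite invr_gt0.
  by exists x.
have x_cauchy n m : (n <= m)%N -> rnorm (x m - x n) <= 2 * C * r n.
  move=> nm; have := TC _ (subspaceB sN (x_lim m).1 (x_lim n).1).
  move/le_trans; apply; rewrite [2 * C]mulrC -mulrA ler_wpM2l// TB.
  have := rnormD (y - T (x n)) (- (y - T (x m))).
  rewrite rnormN opprB addrC addrA subrK.
  have := (x_lim n).2; have := (x_lim m).2; have := rW _ _ nm; lra.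
have [d d0|l l_lim] := complete_rnorm _ x_cauchy.
  by apply: r_small => //; rewrite mulr_ge0.
have Nl : N l.
  apply: cN => e e0.
  have [n ne] := r_small (2 * C) _ (mulr_ge0 (ler0n _ 2) C0) e0.
  by exists (x n); [exact: (x_lim n).1|exact: le_lt_trans ne].
exists l => //; apply/esym/eqP; rewrite -subr_eq0; apply/eqP/rnorm0_eq0.
apply/eqP; rewrite eq_le rnorm_ge0 andbT.
apply/ler_addgt0Pr => e e0; rewrite add0r.
have [|n ne] := r_small (1 + K * (2 * C)) e _ e0.
  by rewrite addr_ge0// !mulr_ge0.
apply/ltW/(le_lt_trans _ ne).
have -> : y - T l = (y - T (x n)) + T (x n - l) by rewrite TB addrA subrK.
apply: le_trans (rnormD _ _) _; rewrite mulrDl mul1r.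
apply: lerD; first exact/ltW/(x_lim n).2.
by rewrite (le_trans (TK _))// -mulrA ler_wpM2l// rnormB.
Qed.

Lemma op_hornerB (p : {poly R[i]}) T x y :
  linear T -> op_horner p T (x - y) = op_horner p T x - op_horner p T y.
Proof.
move=> /linear_funP[_ _ _ TB]; rewrite /op_horner -sumrB.
apply: eq_bigr => i _; rewrite -scalerBr; congr (_ *: _).
by elim: (i : nat) => //= n ->; rewrite TB.
Qed.

Lemma op_horner_ker (p : {poly R[i]}) T x :
  linear T -> T x = 0 -> op_horner p T x = p`_0 *: x.
Proof.
move=> /linear_funP[T0 _ _ _] Tx; rewrite /op_horner.
case: (posnP (size p)) => [p0|].
  by rewrite p0 big_ord0 nth_default ?p0// scale0r.
case: (size p) => // n _; rewrite big_ord_recl/= big1 ?addr0// => i _.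
rewrite (_ : T _ = 0) ?scaler0//.
by elim: (i : nat) => //= m ->.
Qed.

End Operators.

(** * Projections, adjoints and uniform boundedness *)

Section Hilbert.
Context {R : realType} {H : completeNormedModType R[i]}.
Variables (dot : {dot H for Num.conj}) (hdot : induces_norm dot).
Implicit Types (x y z : H) (S : set H) (T : H -> H).

Local Notation ip x y := (complex.Re (dot x y)).

(** The projection is the limit of a minimizing sequence [u] for the distance
    from [x] to [S]. By [ip_le], [x - u n] is orthogonal to [S] up to [r n];
    pairing the difference of [x - u n] and [x - u m] with the vector
    [u m - u n] of [S] bounds its norm by [r n + r m], so [u] converges, and the
    orthogonality becomes exact at the limit. *)
Theorem orthogonal_projection S x : subspace S -> closed S ->
  exists2 p, S p & forall s, S s -> dot (x - p) s = 0.
Proof.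
move=> sS /closed_rnorm cS.
pose D := [set rnorm (x - s) ^+ 2 | s in S].
have D_inf : has_inf D.
  split; first by exists (rnorm (x - 0) ^+ 2), 0; first exact: sS.1.
  by exists 0 => _ [s _ <-]; rewrite sqr_ge0.
have d_le s : S s -> inf D <= rnorm (x - s) ^+ 2.
  by move=> Ss; apply: ge_inf; [exact: D_inf.2|exists s].
pose r n : R := n.+1%:R^-1.
have r0 n : 0 <= r n by rewrite invr_ge0.
have r_small d : 0 < d -> exists n, r n + r n < d.
  move=> d0; have [n nd] := div_nat_lt (ler0n R 2) d0.
  by exists n; rewrite -mulr2n -mulr_natl.
have rW n m : (n <= m)%N -> r m <= r n.
  by move=> nm; rewrite lef_pV2 ?posrE ?ltr0n// ler_nat.
have /choice[u u_min] n :
    exists s, S s /\ rnorm (x - s) ^+ 2 <= inf D + r n ^+ 2.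
  have [|_ [s Ss <-] /ltW sD] := inf_adherent _ D_inf (eps := r n ^+ 2).
    by rewrite exprn_gt0// invr_gt0.
  by exists s.
have Su n : S (u n) by case: (u_min n).
have u_orth n s : S s -> ip (x - u n) s <= r n * rnorm s.
  move=> Ss; apply: ip_le => // t; apply: le_trans (u_min n).2 _.
  rewrite lerD2r -addrA -opprD; apply: d_le.
  by rewrite addrC; apply: sS.2.
have u_cauchy n m : (n <= m)%N -> rnorm (u m - u n) <= r n + r n.
  move=> nm; set s := u m - u n.
  have Ss : S s by apply: subspaceB.
  have : rnorm s ^+ 2 <= (r n + r n) * rnorm s.
    rewrite (rnorm_sqr hdot).
    have -> : ip s s = ip (x - u n) s + ip (x - u m) (- s).
      by rewrite linearNr raddfN -ipBl opprD addrACA subrr add0r opprK addrC.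
    rewrite mulrDl lerD ?u_orth// (le_trans (u_orth _ _ _)) ?rnormN//.
      exact: subspaceN.
    by rewrite ler_wpM2r ?rnorm_ge0 ?rW.
  have := rnorm_ge0 s; rewrite le_eqVlt => /predU1P[<- _|s0].
    by rewrite addr_ge0.
  by rewrite expr2 ler_pM2r.
have [p p_lim] := complete_rnorm r_small u_cauchy.
have Sp : S p.
  apply: cS => e e0; have [n rn] := r_small _ e0.
  by exists (u n) => //; apply: le_lt_trans rn.
have re0 s : S s -> ip (x - p) s <= 0.
  move=> Ss; apply/ler_addgt0Pr => e e0; rewrite add0r.
  have s1 : 0 < 1 + rnorm s by rewrite ltr_pwDl// rnorm_ge0.
  have [|n rn] := r_small (e / 2 / (1 + rnorm s)); first by rewrite !divr_gt0.
  have -> : x - p = (x - u n) - (p - u n) by rewrite opprB addrA subrK.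
  rewrite ipBl.
  have h1 := u_orth n s Ss.
  have h2 := ip_rnorm hdot (- (p - u n)) s.
  rewrite rnormN linearNl raddfN/= in h2.
  have h3 := p_lim n.
  have h4 : (r n + r n) * (1 + rnorm s) < e / 2 by rewrite -ltr_pdivlMr.
  have h5 : rnorm (p - u n) * rnorm s <= (r n + r n) * rnorm s.
    by rewrite ler_wpM2r ?rnorm_ge0.
  have h6 := r0 n; have h7 := rnorm_ge0 s.
  by move: h1 h2 h3 h4 h5; nra.
have re_eq0 s : S s -> ip (x - p) s = 0.
  move=> Ss; apply/eqP; rewrite eq_le re0//= -oppr_le0 -raddfN/= -linearNr.
  by apply: re0; apply: subspaceN.
(* the real part of the product with ['i *: s] is the imaginary part for [s] *)
exists p => // s Ss; have := re_eq0 _ (subspaceZ 'i sS Ss); have := re_eq0 _ Ss.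
rewrite linearZr_LR/=; case: (dot _ s) => a b /= ->.
by rewrite mul0r sub0r mulN1r opprK => ->.
Qed.

(** The kernel of a nonzero [f] is a closed hyperplane; a vector [v] orthogonal
    to it represents [f] up to a scalar, because [x] and [(f x / f v) *: v]
    differ by an element of the kernel. *)
Theorem riesz_representation (f : H -> R[i]) (K : R) :
  (forall a x y, f (a *: x + y) = a * f x + f y) -> 0 <= K ->
  (forall x, complex.Re `|f x| <= K * rnorm x) ->
  exists z, forall x, f x = dot x z.
Proof.
move=> fL K0 fK.
have f0 : f 0 = 0.
  have /eqP := fL 1 0 0.
  by rewrite scaler0 addr0 mul1r -subr_eq subrr => /eqP.
have fB x y : f (x - y) = f x - f y by rewrite addrC -scaleN1r fL mulN1r addrC.
have [f00|/existsNP[x0 fx0]] := pselect (forall x, f x = 0).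
  by exists 0 => x; rewrite f00 linear0r.
have sker : subspace [set x | f x = 0].
  by split=> // a x y /= fx fy; rewrite fL fx fy mulr0 addr0.
have cker : closed [set x | f x = 0].
  apply/closed_rnorm => x xker /=.
  suff : complex.Re `|f x| <= 0.
    move=> fx; apply/normr0_eq0/eqP; rewrite eq_le normr_ge0 andbT.
    by rewrite -[`|_|]RRe_real ?normr_real// lecR.
  apply/ler_addgt0Pr => e e0; rewrite add0r.
  have K1 : 0 < 1 + K by rewrite ltr_pwDl.
  have [s /= fs xs] := xker (e / (1 + K)) (divr_gt0 e0 K1).
  have := fK (x - s); rewrite fB fs subr0 => fxK.
  move: xs; rewrite ltr_pdivlMr// => xs.
  apply/(le_trans fxK)/ltW/(le_lt_trans _ xs).
  by rewrite mulrDr mulr1 [K * _]mulrC lerDr rnorm_ge0.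
have [p fp px0] := orthogonal_projection x0 sker cker.
set v := x0 - p in px0.
have fv : f v = f x0 by rewrite fB fp subr0.
have fv0 : f v != 0 by rewrite fv; apply/eqP.
have v0 : dot v v != 0.
  rewrite dnorm_eq0; apply/eqP => v0; move: fv0.
  by rewrite v0 f0 eqxx.
(* the conjugate offsets the antilinearity of [dot] in its second argument *)
exists ((f v / dot v v)^* *: v) => x.
have /eqP : dot (x - (f x / f v) *: v) v = 0.
  apply/dot_eq0C/px0 => /=.
  by rewrite addrC -scaleNr fL mulNr divfK// addNr.
rewrite linearBl/= linearZl_LR/= subr_eq0 => /eqP xv.
rewrite linearZr_LR/= xv conjCK; field; exact/andP.
Qed.

Lemma is_adjoint_inj T (S1 S2 : H -> H) :
  is_adjoint dot T S1 -> is_adjoint dot T S2 -> S1 = S2.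
Proof.
move=> [_ T1] [_ T2]; apply/funext => y; apply: (dot_inj hdot) => x.
by rewrite -T1 T2.
Qed.

(** [adjoint dot T y] represents the bounded functional [dot (T _) y]. *)
Lemma adjointP T : bounded_operator T -> is_adjoint dot T (adjoint dot T).
Proof.
move=> /bounded_rnorm[lT [K K0 TK]]; apply: getPex.
have /choice[S TS] y : exists z, forall x, dot (T x) y = dot x z.
  apply: (@riesz_representation (fun x => dot (T x) y) (K * rnorm y)).
  - by move=> a x z; rewrite lT linearPl.
  - by rewrite mulr_ge0// rnorm_ge0.
  - move=> x; rewrite (le_trans (dot_rnorm hdot _ _))// mulrAC.
    by rewrite ler_wpM2r ?rnorm_ge0.
exists S; split=> //; apply/bounded_rnorm; split.
  move=> a x y; apply: (dot_inj hdot) => z.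
  by rewrite -TS !linearPr/= !TS.
exists K => // y.
have := rnorm_ge0 (S y); rewrite le_eqVlt => /predU1P[<-|Sy0].
  by rewrite mulr_ge0// rnorm_ge0.
rewrite -(ler_pM2l Sy0) -expr2 (rnorm_sqr hdot) -TS.
rewrite (le_trans (ip_rnorm hdot _ _))// mulrCA mulrA.
by rewrite ler_wpM2r ?rnorm_ge0.
Qed.

Lemma adjoint_eq T (S : H -> H) : is_adjoint dot T S -> adjoint dot T = S.
Proof. by move=> TS; apply: is_adjoint_inj (TS); apply: getPex; exists S. Qed.

(** The uniform boundedness principle for functionals [dot ^~ w], by a gliding
    hump. Were [W] unbounded, choose [w n] in [W] with norm above
    [2 * n%:R * 3 ^+ n] and build a sequence [u] in which step [n] has length
    at most [3 ^- n] but makes the real part of the product with [w n] at least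
    [3 ^- n * rnorm (w n)] in modulus. All later steps together have length at
    most half of [3 ^- n], so at least half of that value survives at the
    limit, where it is at least [n] for each [n]. *)
Theorem weakly_bounded_rnorm (W : set H) :
  (forall x, exists K : R, forall w, W w -> ip x w <= K) ->
  exists2 K : R, 0 <= K & forall w, W w -> rnorm w <= K.
Proof.
move=> Wx; apply: contrapT => W_unb.
have big (K : R) : exists w, W w /\ K < rnorm w.
  apply: contrapT => noK; apply: W_unb; exists `|K| => // w Ww.
  rewrite leNgt; apply/negP => Kw; apply: noK; exists w; split=> //.
  by rewrite (le_lt_trans (ler_norm _)).
have three0 n : 0 < 3 ^+ n :> R by rewrite exprn_gt0.
have three_r n : 3 ^- n.+1 = 3 ^- n / 3 :> R by rewrite exprSr invfM.
have /choice[w w_big] n := big (2 * n%:R * 3 ^+ n).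
have wn0 n : 0 < rnorm (w n).
  by apply: le_lt_trans (w_big n).2; rewrite !mulr_ge0// ltW.
have /choice[h h_step] (nx : nat * H) : exists h, rnorm h <= 3 ^- nx.1 /\
    3 ^- nx.1 * rnorm (w nx.1) <= `|ip (nx.2 + h) (w nx.1)|.
  case: nx => n x /=; set t := 3 ^- n / rnorm (w n).
  have t0 : 0 <= t by rewrite divr_ge0 ?rnorm_ge0// invr_ge0 ltW.
  have tw : rnorm (t%:C *: w n) = 3 ^- n.
    by rewrite rnormZr ger0_norm// divfK// gt_eqF.
  have ttw : t * ip (w n) (w n) = 3 ^- n * rnorm (w n).
    by rewrite -(rnorm_sqr hdot) expr2 mulrA divfK// gt_eqF.
  (* moving along [w n] in the direction of the sign of [ip x (w n)] cannot
     cancel what is already there *)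
  have [xw|xw] := leP 0 (ip x (w n)).
    exists (t%:C *: w n); rewrite tw; split=> //.
    by rewrite (le_trans _ (ler_norm _))// ipDl ipZl ttw lerDr.
  exists (- (t%:C *: w n)); rewrite rnormN tw; split=> //.
  rewrite -normrN (le_trans _ (ler_norm _))// ipBl ipZl ttw opprB lerDl.
  by rewrite oppr_ge0 ltW.
pose u := fix u n := if n is m.+1 then u m + h (m, u m) else 0.
have u_tele n k : rnorm (u (n + k)%N - u n) <= 3 / 2 * (3 ^- n - 3 ^- (n + k)).
  elim: k => [|k IH]; first by rewrite addn0 !subrr rnorm0 mulr0.
  rewrite addnS /= addrAC (le_trans (rnormD _ _))//.
  have := (h_step ((n + k)%N, u (n + k)%N)).1; rewrite /= three_r.
  by move: IH; lra.
have r3_gt0 n : 0 < 3 ^- n :> R by rewrite invr_gt0.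
have u_cauchy n m : (n <= m)%N -> rnorm (u m - u n) <= 3 / 2 * 3 ^- n.
  move=> /subnKC <-; apply: le_trans (u_tele _ _) _.
  by rewrite ler_pM2l ?divr_gt0// gerBl ltW.
have r_small (d : R) : 0 < d -> exists n, 3 / 2 * 3 ^- n < d.
  move=> d0; have [n nd] := div_nat_lt (divr_ge0 (ler0n R 3) (ler0n R 2)) d0.
  exists n; apply: le_lt_trans nd; rewrite ler_pM2l ?divr_gt0//.
  by rewrite lef_pV2 ?posrE ?ltr0n// -natrX ler_nat ltn_expl.
have [l l_lim] := complete_rnorm r_small u_cauchy.
have l_big n : n%:R <= `|ip l (w n)|.
  have h1 : 3 ^- n * rnorm (w n) <= `|ip (u n.+1) (w n)|.
    exact: (h_step (n, u n)).2.
  have h2 := l_lim n.+1.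
  have h3 : `|ip l (w n) - ip (u n.+1) (w n)| <=
            rnorm (l - u n.+1) * rnorm (w n).
    rewrite -ipBl ler_norml (ip_rnorm hdot) andbT lerNl -raddfN/= -linearNl.
    by rewrite (le_trans (ip_rnorm hdot _ _))// rnormN.
  have h4 : n%:R <= 3 ^- n * rnorm (w n) / 2.
    rewrite ler_pdivlMr// mulrC -ler_pdivrMl// invrK ltW//.
    by have := (w_big n).2; lra.
  have h5 : rnorm (l - u n.+1) * rnorm (w n) <= 3 ^- n * rnorm (w n) / 2.
    rewrite mulrAC ler_pM2r// (le_trans h2)// three_r; lra.
  have h6 := ler_normB (ip l (w n)) (ip l (w n) - ip (u n.+1) (w n)).
  by move: h1 h6; rewrite opprB addrCA subrr addr0; lra.
(* the bounds given by [Wx] are one-sided: [- l] gives the other side *)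
have [K1 lK1] := Wx l; have [K2 lK2] := Wx (- l).
pose n := (Num.truncn (Num.max K1 K2)).+1.
have := lt_le_trans (truncnS_gt (Num.max K1 K2)) (l_big n).
have Wn := (w_big n).1.
rewrite ltNge => /negP; apply; rewrite ler_norml lerNl !le_max lK1// andbT.
by rewrite -raddfN/= -linearNl/= lK2 ?orbT.
Qed.

End Hilbert.

(** * The Moore-Penrose inverse *)

Section MoorePenrose.
Context {R : realType} {H : completeNormedModType R[i]}.
Variables (dot : {dot H for Num.conj}) (hdot : induces_norm dot).
Variables (T : H -> H) (bT : bounded_operator T) (cT : closed (range T)).

Local Notation ip x y := (complex.Re (dot x y)).
Let Ts := adjoint dot T.
Let N := range T.

Let TsE x y : dot (T x) y = dot x (Ts y).
Proof. exact: (adjointP hdot bT).2. Qed.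

Let TE x y : dot x (T y) = dot (Ts x) y.
Proof. by rewrite dotC TsE -dotC. Qed.

Let bTs : bounded_operator Ts.
Proof. exact: (adjointP hdot bT).1. Qed.

Let sN : subspace N.
Proof. by apply: subspace_image; [exact: bT.1|]. Qed.

(** The quantitative form of the closedness of the range, by uniform
    boundedness: the set of [w] in the range with
    [rnorm (adjoint dot T w) <= 1] is weakly bounded, because the product of
    [x] with [w] only depends on the projection [T z] of [x] on the closed
    range, and [dot (T z) w = dot z (adjoint dot T w)]. *)
Lemma adjoint_bounded_below : exists2 C : R, 0 <= C &
  forall w, range T w -> rnorm w <= C * rnorm (adjoint dot T w).
Proof.
have [_ TsZ _ _] := linear_funP bTs.1.
pose W := [set w | N w /\ rnorm (Ts w) <= 1].
have [|C C0 WC] := weakly_bounded_rnorm hdot (W := W).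
  move=> x; have [p [z _ <-] xp] := orthogonal_projection hdot x sN cT.
  exists (rnorm z) => w /= [Nw Tw1].
  have -> : ip x w = ip z (Ts w).
    have := xp _ Nw; rewrite linearBl/= => /eqP.
    by rewrite subr_eq0 => /eqP ->; rewrite TsE.
  rewrite (le_trans (ip_rnorm hdot _ _))// -[leRHS]mulr1 ler_wpM2l//.
  exact: rnorm_ge0.
exists C => // w Nw; have := rnorm_ge0 (Ts w).
rewrite le_eqVlt => /predU1P[/esym/rnorm0_eq0 Tw0|Tw0].
  have -> : w = 0; last by rewrite rnorm0 mulr_ge0// rnorm_ge0.
  apply/eqP; rewrite -(dnorm_eq0 dot); have [z _ zw] := Nw.
  by rewrite -{1}zw TsE Tw0 linear0r.
rewrite -ler_pdivrMr// mulrC.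
have -> : (rnorm (Ts w))^-1 * rnorm w = rnorm ((rnorm (Ts w))^-1%:C *: w).
  by rewrite rnormZr ger0_norm// invr_ge0 ltW.
apply: WC; split; first exact: subspaceZ.
by rewrite TsZ rnormZr ger0_norm ?mulVf ?gt_eqF// invr_ge0 ltW.
Qed.

(** With [N] the range of [T] and [Ts] its adjoint, [T \o Ts] restricts to a
    bijection of [N]. It is injective since [Ts] is bounded below on [N]. It is
    surjective since [Ts @` N] is closed for the same reason: a vector [b]
    orthogonal to [Ts @` N] has [T b] in [N] and orthogonal to [N], so that [b]
    is in the kernel of [T]; hence [T z] does not change when [z] is projected
    on [Ts @` N]. Let [g y] be the preimage in [N] of the projection of [y] on
    [N]. Then [g] is bounded and symmetric, and [Ts \o g] is the Moore-Penrose
    inverse: [T \o (Ts \o g)] is the projection on [N], and [Ts \o g \o T] is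
    symmetric like [g]. *)
Theorem mp_inverse_exists : exists S, is_mp_inverse dot T S.
Proof.
have [C C0 TsC] := adjoint_bounded_below.
have [T0 TZ TD TB] := linear_funP bT.1.
have [Ts0 TsZ TsD TsB] := linear_funP bTs.1.
have NT x : N (T x) by exists x.
have N_orth0 y : N y -> (forall v, N v -> dot y v = 0) -> y = 0.
  by move=> Ny /(_ _ Ny)/eqP; rewrite dnorm_eq0 => /eqP.
have TTs_inj w : N w -> (forall v, N v -> dot (T (Ts w)) v = 0) -> w = 0.
  move=> Nw /(_ _ Nw)/eqP; rewrite TsE dnorm_eq0 => /eqP Tw0.
  apply: rnorm0_eq0; apply/eqP; rewrite eq_le rnorm_ge0 andbT.
  by rewrite (le_trans (TsC _ Nw))// -/Ts Tw0 rnorm0 mulr0.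
have /choice[g gP] y :
    exists w, N w /\ forall v, N v -> dot (y - T (Ts w)) v = 0.
  have [_ [z _ <-] yTz] := orthogonal_projection hdot y sN cT.
  have [||_ [w Nw <-] zw] := @orthogonal_projection _ _ _ hdot (Ts @` N) z.
  - by apply: subspace_image; [exact: bTs.1|].
  - exact: closed_image sN cT C0 TsC.
  exists w; split=> //; suff <- : T z = T (Ts w) by [].
  apply/eqP; rewrite -subr_eq0 -TB; apply/eqP/N_orth0 => // v Nv.
  by rewrite TsE zw//; exists v.
have Ng y : N (g y) := (gP y).1.
have g_orth y v : N v -> dot y v = dot (T (Ts (g y))) v.
  by move=> /(gP y).2; rewrite linearBl/= => /eqP; rewrite subr_eq0 => /eqP.
have g_uniq y w :
    N w -> (forall v, N v -> dot y v = dot (T (Ts w)) v) -> g y = w.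
  move=> Nw yw; apply/eqP; rewrite -subr_eq0; apply/eqP/TTs_inj.
    exact: subspaceB.
  by move=> v Nv; rewrite TsB TB linearBl/= -yw// -g_orth// subrr.
have bg : bounded_operator g.
  apply/bounded_rnorm; split.
    move=> a x y; apply: g_uniq => [|v Nv]; first exact: sN.2.
    by rewrite TsD TsZ TD TZ !linearPl/= -!g_orth.
  exists (C ^+ 2) => [|y]; first exact: sqr_ge0.
  have := rnorm_ge0 (g y); rewrite le_eqVlt => /predU1P[<-|gy0].
    by rewrite mulr_ge0 ?sqr_ge0// rnorm_ge0.
  rewrite -(ler_pM2r gy0) -expr2.
  apply: (@le_trans _ _ ((C * rnorm (Ts (g y))) ^+ 2)).
    have n0 := rnorm_ge0 (Ts (g y)).
    by apply: lerXn2r (TsC _ (Ng y)); rewrite nnegrE ?rnorm_ge0 ?mulr_ge0.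
  rewrite exprMn -[leRHS]mulrA ler_wpM2l ?sqr_ge0//.
  rewrite (rnorm_sqr hdot) -TsE -g_orth//.
  exact: ip_rnorm.
have gC x y : dot (g x) y = dot x (g y).
  by rewrite dotC g_orth// TsE -dotC -TsE -g_orth.
have bS : bounded_operator (Ts \o g) by apply: bounded_operator_comp.
exists (Ts \o g); split=> //.
- apply/funext => x /=; apply/esym/eqP; rewrite -subr_eq0; apply/eqP/N_orth0.
    by rewrite -TB.
  by move=> v Nv; rewrite linearBl/= -g_orth// subrr.
- by apply/funext => y /=; congr Ts; apply: g_uniq.
- apply: (adjoint_eq hdot); split; first exact: bounded_operator_comp.
  by move=> x y /=; rewrite -TE gC TsE.
- apply: (adjoint_eq hdot); split; first exact: bounded_operator_comp.
  by move=> x y /=; rewrite [LHS]dotC g_orth// -dotC [RHS]g_orth.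
Qed.

Lemma mp_inverseP : is_mp_inverse dot T (mp_inverse dot T).
Proof. exact: getPex mp_inverse_exists. Qed.

Let Td := mp_inverse dot T.

Let bTd : bounded_operator Td.
Proof. by case: mp_inverseP. Qed.

Let TTdT x : T (Td (T x)) = T x.
Proof. by have [_ /(congr1 (@^~ x))] := mp_inverseP. Qed.

Let TdTC x y : dot (Td (T x)) y = dot x (Td (T y)).
Proof.
have [_ _ _ PE _] := mp_inverseP.
by have := (adjointP hdot (bounded_operator_comp bTd bT)).2 x y; rewrite PE.
Qed.

Let TTdC x y : dot (T (Td x)) y = dot x (T (Td y)).
Proof.
have [_ _ _ _ PE] := mp_inverseP.
by have := (adjointP hdot (bounded_operator_comp bT bTd)).2 x y; rewrite PE.
Qed.

(** The adjoint of the identity [T \o Td \o T = T], as [Td \o T] is symmetric. *)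
Lemma mp_inverseK_adjoint y :
  mp_inverse dot T (T (adjoint dot T y)) = adjoint dot T y.
Proof.
by apply: (dot_inj hdot) => x; rewrite -TdTC -!TsE TTdT.
Qed.

(** The adjoint of the same identity, as [T \o Td] is symmetric. *)
Lemma adjointK_mp_inverse y :
  adjoint dot T (T (mp_inverse dot T y)) = adjoint dot T y.
Proof. by apply: (dot_inj hdot) => x; rewrite -!TsE -TTdC TTdT. Qed.

(** [Td \o T], being symmetric, equals its own adjoint; in particular its range
    is contained in that of the adjoint of [T]. *)
Lemma mp_inverse_mulE y :
  mp_inverse dot T (T y) = adjoint dot T (adjoint dot (mp_inverse dot T) y).
Proof.
by apply: (dot_inj hdot) => x; rewrite -TsE -(adjointP hdot bTd).2 TdTC.
Qed.

Lemma mp_inverse_compl_ker x : T (x - mp_inverse dot T (T x)) = 0.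
Proof. by have [_ _ _ ->] := linear_funP bT.1; rewrite TTdT subrr. Qed.

End MoorePenrose.

(** * The equivalence *)

Theorem theorem4 (R : realType) (H : completeNormedModType R[i])
    (dot : {dot H for Num.conj}) (hdot : induces_norm dot)
    (T : H -> H) (hT : bounded_operator T) (hcl : closed (range T))
    (p : {poly R[i]}) :
  let Td := mp_inverse dot T in
  let Ts := adjoint dot T in
  let pT := op_horner p T in
  (hypo_EP dot p T <-> Td \o T \o pT \o Ts \o T = pT \o Ts \o T) /\
  (Td \o T \o pT \o Ts \o T = pT \o Ts \o T <->
   Td \o T \o pT \o Ts = pT \o Ts).
Proof.
move=> Td Ts pT.
have EP_Ts : hypo_EP dot p T -> Td \o T \o pT \o Ts = pT \o Ts.
  move=> hEP; apply/funext => x /=; have /= := congr1 (@^~ (Ts x)) hEP.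
  by rewrite -/pT -/Td => ->; rewrite /Td /Ts mp_inverseK_adjoint.
have Ts_TsT : Td \o T \o pT \o Ts = pT \o Ts ->
    Td \o T \o pT \o Ts \o T = pT \o Ts \o T by move=> ->.
have TsT_Ts : Td \o T \o pT \o Ts \o T = pT \o Ts \o T ->
    Td \o T \o pT \o Ts = pT \o Ts.
  move=> hTsT; apply/funext => x /=; have /= := congr1 (@^~ (Td x)) hTsT.
  by rewrite /Ts /Td adjointK_mp_inverse.
have Ts_EP : Td \o T \o pT \o Ts = pT \o Ts -> hypo_EP dot p T.
  move=> hTs; apply/funext => x /=; rewrite -/pT -/Td.
  have lT := hT.1; have [_ _ _ TB] := linear_funP lT.
  have [[lTd _] _ _ _ _] := mp_inverseP hdot hT hcl.
  have [Td0 _ _ TdB] := linear_funP lTd.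
  (* [x] splits into a part in the kernel of [T], on which [pT] is a scalar and
     [Td \o T] vanishes, and a part in the range of [Ts], to which the
     hypothesis applies *)
  have ker0 : Td (T (pT (x - Td (T x)))) = 0.
    rewrite /pT op_horner_ker ?mp_inverse_compl_ker//.
    have [_ TZ _ _] := linear_funP lT.
    by rewrite TZ mp_inverse_compl_ker// scaler0 /Td Td0.
  apply/eqP; rewrite -subr_eq0; apply/eqP.
  have PpP : Td (T (pT (Td (T x)))) = pT (Td (T x)).
    rewrite /Td (mp_inverse_mulE hdot hT hcl x).
    exact: (congr1 (@^~ (adjoint dot Td x)) hTs).
  by move: ker0; rewrite /pT op_hornerB// TB /Td TdB -/pT -/Td PpP.
by split; split=> // ?; auto.
Qed.
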